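(* Let $R$ be a nonzero ring and $M$ a monoid (neither is assumed commutative). Then the cardinality of the monoid-ring $R[M]$ is $|R|^{|M|}$ if $M$ is finite, and it is $|R| \times |M|$ if $M$ is infinite.
   Context: We work in ZFC; $|X|$ denotes the cardinality of a set $X$, and $|R|\times|M|$ is the product of cardinals. Rings are associative with identity. The monoid-ring $R[M]$ has as underlying additive group $\bigoplus_{x\in M} R$, i.e. the set of all functions $M \to R$ which are zero at all but finitely many elements of $M$. *)

(* Defs.v *)
From HB Require Import structures.
From mathcomp Require Import all_boot all_algebra finmap.
From mathcomp Require Import boolp classical_sets functions cardinality.
From mathcomp Require Import monalg.

Set Implicit Arguments.
Unset Strict Implicit.
Unset Printing Implicit Defensive.

Import GRing.Theory.

Local Open Scope fset_scope.
Local Open Scope ring_scope.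

(* {malg R[M]} consists of the finitely supported functions from M to R.  Its
   library ring structure requires a monomType, in which x * y = 1 forces
   x = y = 1; the alias below carries the convolution product for an arbitrary
   monoid M instead. *)
Definition monoid_ring (R : nzRingType) (M : monoidType) : Type := {malg R[M]}.

HB.instance Definition _ (R : nzRingType) (M : monoidType) :=
  GRing.Zmodule.copy (monoid_ring R M) {malg R[M]}.

Section MonoidRing.
Context (R : nzRingType) (M : monoidType).
Implicit Types (f g h : {malg R[M]}) (x y : M) (a b : R).

Definition mr_one : {malg R[M]} := << (1 : R) *g (1%g : M) >>.

Definition mr_mul f g : {malg R[M]} :=
  \sum_(x <- msupp f) \sum_(y <- msupp g) << f@_x * g@_y *g (x * y)%g >>.

Lemma mr_mulw (d1 d2 : {fset M}) f g : msupp f `<=` d1 -> msupp g `<=` d2 ->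
  mr_mul f g =
  \sum_(x <- d1) \sum_(y <- d2) << f@_x * g@_y *g (x * y)%g >>.
Proof.
move=> le_d1 le_d2; rewrite /mr_mul (big_fset_incl _ le_d1) /=.
  apply/eq_bigr=> x _; apply/big_fset_incl => // y _ /mcoeff_outdom ->.
  by rewrite mulr0 monalgU0.
move=> x _ /mcoeff_outdom fx.
by rewrite big1 => // y _; rewrite fx mul0r monalgU0.
Qed.

Lemma mr_mulUU a b x y :
  mr_mul << a *g x >> << b *g y >> = << a * b *g (x * y)%g >>.
Proof. by rewrite (mr_mulw msuppU_le msuppU_le) !big_seq_fset1 !mcoeffUU. Qed.

Lemma mr_mulDl : left_distributive mr_mul +%R.
Proof.
move=> f g h.
rewrite (mr_mulw (msuppD_le f g) (fsubset_refl _)).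
rewrite (mr_mulw (fsubsetUl _ (msupp g)) (fsubset_refl (msupp h))).
rewrite (mr_mulw (fsubsetUr (msupp f) _) (fsubset_refl (msupp h))).
rewrite -big_split /=; apply/eq_bigr=> x _.
rewrite -big_split /=; apply/eq_bigr=> y _.
by rewrite mcoeffD mulrDl monalgUD.
Qed.

Lemma mr_mulDr : right_distributive mr_mul +%R.
Proof.
move=> h f g.
rewrite (mr_mulw (fsubset_refl _) (msuppD_le f g)).
rewrite (mr_mulw (fsubset_refl (msupp h)) (fsubsetUl _ (msupp g))).
rewrite (mr_mulw (fsubset_refl (msupp h)) (fsubsetUr (msupp f) _)).
rewrite -big_split /=; apply/eq_bigr=> x _.
rewrite -big_split /=; apply/eq_bigr=> y _.
by rewrite mcoeffD mulrDr monalgUD.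
Qed.

Lemma mr_mul0g : left_zero 0 mr_mul.
Proof. by move=> g; rewrite /mr_mul msupp0 big_seq_fset0. Qed.

Lemma mr_mulg0 : right_zero 0 mr_mul.
Proof.
by move=> f; rewrite /mr_mul msupp0 big1 // => x _; rewrite big_seq_fset0.
Qed.

Lemma mr_mul_suml (I : Type) (r : seq I) (F : I -> {malg R[M]}) g :
  mr_mul (\sum_(i <- r) F i) g = \sum_(i <- r) mr_mul (F i) g.
Proof.
exact: (big_morph (mr_mul^~ g) (fun f h => mr_mulDl f h g) (mr_mul0g g)).
Qed.

Lemma mr_mul_sumr (I : Type) (r : seq I) (F : I -> {malg R[M]}) f :
  mr_mul f (\sum_(i <- r) F i) = \sum_(i <- r) mr_mul f (F i).
Proof. exact: (big_morph (mr_mul f) (mr_mulDr f) (mr_mulg0 f)). Qed.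

Lemma mr_mul1g : left_id mr_one mr_mul.
Proof.
move=> g; rewrite [in LHS](monalgE g) mr_mul_sumr [RHS]monalgE.
by apply/eq_bigr=> y _; rewrite mr_mulUU mul1r mul1g.
Qed.

Lemma mr_mulg1 : right_id mr_one mr_mul.
Proof.
move=> f; rewrite [in LHS](monalgE f) mr_mul_suml [RHS]monalgE.
by apply/eq_bigr=> x _; rewrite mr_mulUU mulr1 mulg1.
Qed.

Lemma mr_mulA : associative mr_mul.
Proof.
move=> f g h; rewrite (monalgE f) !mr_mul_suml; apply/eq_bigr=> x _.
rewrite (monalgE g) mr_mul_sumr !mr_mul_suml mr_mul_sumr; apply/eq_bigr=> y _.
rewrite (monalgE h) !mr_mul_sumr; apply/eq_bigr=> z _.
by rewrite !mr_mulUU mulrA mulgA.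
Qed.

Lemma mr_one_neq0 : mr_one != 0.
Proof. by rewrite monalgU_eq0 oner_eq0. Qed.

End MonoidRing.

HB.instance Definition _ (R : nzRingType) (M : monoidType) :=
  GRing.Zmodule_isNzRing.Build (monoid_ring R M)
    (@mr_mulA R M) (@mr_mul1g R M) (@mr_mulg1 R M)
    (@mr_mulDl R M) (@mr_mulDr R M) (@mr_one_neq0 R M).

(* Main.v *)
(* For M finite, R[M] consists of all functions M -> R.  For M infinite, an
   element is recovered from the finite list of its (coefficient, monomial)
   pairs, so R[M] embeds into the finite sequences over T := R * M, and these
   inject into T because T is infinite: T * T <= T folds a sequence into one
   element, to be paired with its length.  For T * T <= T, take by Zorn a
   maximal injection A * A -> A with A infinite.  If T \ A <= A, then
   T <= A + A <= A * A <= A.  Otherwise T \ A contains a copy B of A, and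
   (A u B) * (A u B) <= A * A <= A injects into B, which extends the injection to
   A u B, contradicting maximality. *)
Require Import Defs.
From mathcomp Require Import all_boot all_algebra.
From mathcomp Require Import finmap monalg boolp functions.
From mathcomp Require Import classical_sets cardinality.

Set Implicit Arguments.
Unset Strict Implicit.
Unset Printing Implicit Defensive.

Local Open Scope classical_set_scope.
Local Open Scope card_scope.

(** * Unions of chains and Zorn's lemma *)

Lemma total_on_bigcup2 (T : Type) (F : set (set T)) (x y : T) :
  total_on F subset -> (\bigcup_(X in F) X) x -> (\bigcup_(X in F) X) y ->
  exists X, [/\ F X, X x & X y].
Proof.
move=> Ftot [X FX Xx] [Y FY Yy].
by have [XY|YX] := Ftot _ _ FX FY; [exists Y|exists X]; split=> //; auto.
Qed.

(** Zorn's lemma is applied to the sets whose union with [A0] satisfies [P]. The empty chain then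
    yields [A0] itself, so closure of [P] is asked for nonempty chains only. *)
Lemma Zorn_bigcup_above (T : Type) (P : set (set T)) (A0 : set T) : P A0 ->
  (forall F : set (set T), F !=set0 -> F `<=` P -> total_on F subset ->
    P (\bigcup_(X in F) X)) ->
  exists A, [/\ P A, A0 `<=` A & forall B, A `<=` B -> P B -> B `<=` A].
Proof.
move=> PA0 Pcup; have [F FP Ftot|A [PA maxA]] :=
    @Zorn_bigcup T [set A | P (A0 `|` A)].
  rewrite /=; have [[X FX]|F0] := pselect (F !=set0); last first.
    rewrite bigcup0 ?setU0// => X FX.
    by exfalso; apply: F0; exists X.
  have -> : A0 `|` \bigcup_(X in F) X =
      \bigcup_(Y in [set A0 `|` X | X in F]) Y.
    rewrite bigcup_image; apply/seteqP; split=> x /=.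
      by move=> [A0x|[Y FY Yx]]; [exists X => //; left|exists Y => //; right].
    by move=> [Y FY [|Yx]]; [left|right; exists Y].
  apply: Pcup; first by exists (A0 `|` X); exists X.
    by move=> _ [Y /FP PY <-].
  move=> _ _ [Y FY <-] [Z FZ <-].
  by have [YZ|ZY] := Ftot _ _ FY FZ; [left|right]; apply: setUS.
exists (A0 `|` A); split=> // B AB PB.
have A0B : A0 `|` B = B by apply/setUidPr => x A0x; apply: AB; left.
apply: contrapT => nBA; apply: (maxA B); last by rewrite /= A0B.
split=> [x Ax|BA]; first by apply: AB; right.
by apply: nBA => x /BA; right.
Qed.

(** * Comparability of cardinals *)

Lemma injective_card_leP (T U : Type) :
  [set: T] #<= [set: U] <-> exists f : T -> U, injective f.
Proof.
elim/Ppointed: U => U.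
  elim/Ppointed: T => T.
    by rewrite !emptyE_subdef; split=> // _; exists any => x; case: (no x).
  split; last by move=> [f _]; case: (no (f point)).
  rewrite !emptyE_subdef. move=> T0.
  by have : [set: T] point by []; rewrite T0.
split=> [/pcard_injP[f finj]|[f finj]].
  by exists f => x y; apply: finj; rewrite in_setT.
by apply/pcard_injP; exists f => x y _ _; apply: finj.
Qed.

(** Take a maximal graph of a partial injection from [A] to [B]. If it missed both some [a] in [A]
    and some [b] in [B], the pair [(a, b)] could be added to it. *)
Lemma card_le_total (T U : Type) (A : set T) (B : set U) :
  A #<= B \/ B #<= A.
Proof.
elim/Ppointed: T => T in A *; first by left; rewrite !emptyE_subdef.
elim/Ppointed: U => U in B *; first by right; rewrite !emptyE_subdef.
pose P := [set G : set (T * U) | G `<=` A `*` B /\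
  forall p q, G p -> G q -> (p.1 = q.1 <-> p.2 = q.2)].
have [F FP Ftot|G [[GAB Ginj] maxG]] := @Zorn_bigcup _ P.
  split=> [p [X /FP[XAB _] /XAB]//|p q Fp Fq].
  by have [X [/FP[_ +] Xp Xq]] := total_on_bigcup2 Ftot Fp Fq; apply.
have [GA|] := pselect (forall a, A a -> exists b, G (a, b)).
  left; have /choice[f fG] a : exists b, A a -> G (a, b).
    by have [/GA[b]|nAa] := pselect (A a); [exists b|exists point].
  apply/pcard_leP/injfunPex; exists f => [a Aa|a b].
    by have [] := GAB _ (fG _ Aa).
  by rewrite !inE => Aa Ab; have [_] := Ginj _ _ (fG _ Aa) (fG _ Ab).
move=> /existsNP[a /not_implyP[Aa nGa]].
have [GB|] := pselect (forall b, B b -> exists a, G (a, b)).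
  right; have /choice[f fG] b : exists a, B b -> G (a, b).
    by have [/GB[c]|nBb] := pselect (B b); [exists c|exists point].
  apply/pcard_leP/injfunPex; exists f => [b Bb|b c].
    by have [] := GAB _ (fG _ Bb).
  by rewrite !inE => Bb Bc; have [+ _] := Ginj _ _ (fG _ Bb) (fG _ Bc).
move=> /existsNP[b /not_implyP[Bb nGb]].
exfalso; apply: (maxG (G `|` [set (a, b)])).
  split=> [p Gp|]; first by left.
  by move=> /(_ (a, b))-/(_ (or_intror erefl)) Gab; apply: nGa; exists b.
split=> [p [/GAB//|->//]|p q [Gp|->] [Gq|->]//=]; first exact: Ginj.
  by case: p Gp => x y Gxy /=; split=> E; exfalso; [apply: nGa; exists y|
    apply: nGb; exists x]; rewrite -E.
by case: q Gq => x y Gxy /=; split=> E; exfalso; [apply: nGa; exists y|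
  apply: nGb; exists x]; rewrite E.
Qed.

Lemma set_injX (T U V : Type) (A : set T) (B : set U) (f : T * U -> V)
    x y x' y' :
  set_inj (A `*` B) f -> A x -> B y -> A x' -> B y' ->
  f (x, y) = f (x', y') -> x = x' /\ y = y'.
Proof.
move=> finj Ax By Ax' By' fxy.
by have [] : (x, y) = (x', y') by apply: finj fxy; rewrite inE.
Qed.

(** * Graphs of injections from a square into its side *)

Section SquareGraph.
Context (T : pointedType).
Implicit Types (A D : set T) (f : T * T -> T) (G : set (T * T * T)).

(** Reading the side of the square off the diagonal lets Zorn's lemma run over plain sets of
    triples. *)
Definition diag_dom G : set T := [set a | exists c, G (a, a, c)].

(* The graphs of the injections from the square [A `*` A] of some [A] into [A],
   which is then [diag_dom G]. *)
Definition square_graph G :=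
  [/\ forall p q, G p -> G q -> (p.1 = q.1 <-> p.2 = q.2),
      forall a b c, G (a, b, c) -> [/\ diag_dom G a, diag_dom G b & diag_dom G c]
    & forall a b, diag_dom G a -> diag_dom G b -> exists c, G (a, b, c)].

Definition graph_on A f : set (T * T * T) :=
  [set p | (A `*` A) p.1 /\ p.2 = f p.1].

Lemma diag_dom_graph_on A f : diag_dom (graph_on A f) = A.
Proof.
apply/seteqP; split=> a; first by case=> c [[]].
by move=> Aa; exists (f (a, a)).
Qed.

Lemma square_graph_on A f :
  set_fun (A `*` A) A f -> set_inj (A `*` A) f -> square_graph (graph_on A f).
Proof.
move=> fA finj; rewrite /square_graph diag_dom_graph_on; split.
- move=> [p c] [q d] [/= Ap ->] [/= Aq ->]; split=> [->//|].
  by apply: finj; rewrite inE.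
- by move=> a b c [/= [Aa Ab] ->]; split=> //; apply: fA.
- by move=> a b Aa Ab; exists (f (a, b)).
Qed.

Lemma square_graphP G : square_graph G -> exists f,
  [/\ set_fun (diag_dom G `*` diag_dom G) (diag_dom G) f,
      set_inj (diag_dom G `*` diag_dom G) f & G = graph_on (diag_dom G) f].
Proof.
case=> Ginj Gdom Gtot; pose A := diag_dom G.
have /choice[f fG] p : exists c, (A `*` A) p -> G (p, c).
  have [|nAp] := pselect ((A `*` A) p); last by exists point.
  by case: p => a b [/= Aa Ab]; have [c Gc] := Gtot _ _ Aa Ab; exists c.
exists f; split.
- by move=> [a b] Aab; have [] := Gdom _ _ _ (fG _ Aab).
- by move=> p q; rewrite !inE => Ap Aq; have [_] := Ginj _ _ (fG _ Ap) (fG _ Aq).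
- apply/seteqP; split=> [[[a b] c] Gabc|[p c] [/= Ap ->]]; last exact: fG.
  have [Aa Ab _] := Gdom _ _ _ Gabc; have Aab : (A `*` A) (a, b) by [].
  by split=> //=; have [+ _] := Ginj _ _ Gabc (fG _ Aab); apply.
Qed.

(** Each condition starts from at most two triples, and these lie in a common member of the
    chain. *)
Lemma square_graph_bigcup (F : set (set (T * T * T))) :
  F `<=` square_graph -> total_on F subset ->
  square_graph (\bigcup_(G in F) G).
Proof.
move=> Fsq Ftot.
have dom_cup G : F G -> diag_dom G `<=` diag_dom (\bigcup_(G in F) G).
  by move=> FG a [c Gc]; exists c, G.
split=> [p q Up Uq|a b c [G FG Gabc]|a b [c Uc] [d Ud]].
- have [G [/Fsq[+ _ _] Gp Gq]] := total_on_bigcup2 Ftot Up Uq.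
  exact.
- have [_ /(_ _ _ _ Gabc)[Ga Gb Gc] _] := Fsq _ FG.
  by split; apply: dom_cup FG _ _.
- have [G [FG Gc Gd]] := total_on_bigcup2 Ftot Uc Ud.
  have [_ _ Gtot] := Fsq _ FG.
  have [||e Ge] := Gtot a b; [by exists c|by exists d|].
  by exists e, G.
Qed.

(* From [A * A <= A] and [D \ A <= A] follows [D <= A + A <= A * A <= A]. *)
Lemma square_absorbs_complement A f (a0 a1 : T) D (d : T -> T) :
  set_fun (A `*` A) A f -> set_inj (A `*` A) f -> A a0 -> A a1 -> a0 <> a1 ->
  set_fun (D `\` A) A d -> set_inj (D `\` A) d ->
  exists2 c : T -> T, set_fun D A c & set_inj D c.
Proof.
move=> fA finj Aa0 Aa1 a01 dA dinj.
have dAD x : D x -> ~ A x -> A (d x) by move=> Dx nAx; apply: dA.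
(* The second coordinates [a0] and [a1] tag the two copies of [A] inside [A * A]. *)
exists (fun x => if x \in A then f (x, a0) else f (d x, a1)).
  move=> x Dx /=; case: ifPn; rewrite ?inE ?notin_setE => Ax; apply: fA => //.
  by split=> //=; apply: dAD.
move=> x y; rewrite !inE => Dx Dy.
case: ifPn; rewrite ?inE ?notin_setE => Ax;
  case: ifPn; rewrite ?inE ?notin_setE => Ay.
- by move=> /(set_injX finj Ax Aa0 Ay Aa0)[].
- by move=> /(set_injX finj Ax Aa0 (dAD _ Dy Ay) Aa1)[].
- by move=> /(set_injX finj (dAD _ Dx Ax) Aa1 Ay Aa0)[_ /esym].
- move=> /(set_injX finj (dAD _ Dx Ax) Aa1 (dAD _ Dy Ay) Aa1)[+ _].
  by apply: dinj; rewrite inE.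
Qed.

End SquareGraph.

(** * Squares of infinite types and finite sequences *)

Lemma infinite_square (T : Type) :
  infinite_set [set: T] -> [set: (T * T)%type] #= [set: T].
Proof.
move=> Tinf.
elim/Ppointed: T => T in Tinf *; first by case: Tinf; rewrite emptyE_subdef.
apply: Cantor_Bernstein; last first.
  by apply/injective_card_leP; exists (fun x => (x, x)) => x y [].
move: Tinf => /infiniteP/injective_card_leP[i iinj].
(* The starting point for Zorn is a countable [N], with the pairing of natural numbers carried over
   by [i]. Lying above it makes the maximal [A] infinite. *)
pose m : nat * nat -> nat := choice.pickle.
have minj : injective m := pcan_inj choice.pickleK.
pose N := range i.
have [j ij] : exists j, forall n, j (i n) = n.
  have /choice[j ij] x : exists n, N x -> i n = x.
    by have [[n _ <-]|nx] := pselect (N x); [exists n|exists 0].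
  by exists j => n; apply: iinj; rewrite ij//; exists n.
pose f0 p := i (m (j p.1, j p.2)).
have sq0 : square_graph (graph_on N f0).
  apply: square_graph_on => [p _|[x y] [z t]]; first by exists (m (j p.1, j p.2)).
  rewrite !inE => -[[a _ /= <-] [b _ /= <-]] [[c _ /= <-] [d _ /= <-]].
  by rewrite /f0/= !ij => /iinj/minj[-> ->].
have [F _|G [Gsq G0 maxG]] := Zorn_bigcup_above sq0.
  exact: square_graph_bigcup.
have [f] := square_graphP Gsq.
set A := diag_dom G => -[fA finj GE].
have NA : N `<=` A.
  by rewrite -(diag_dom_graph_on N f0) => a [c /G0]; exists c.
have Ai n : A (i n) by apply: NA; exists n.
have i01 : i 0 <> i 1 by move=> /iinj.
have [/pcard_leP/injfunPex[d dA dinj]|] := card_le_total (~` A) A.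
  have [||c cA cinj] := @square_absorbs_complement _ A f _ _ setT d
      fA finj (Ai 0) (Ai 1) i01; rewrite ?setTD//.
  apply/injective_card_leP; exists (fun p => f (c p.1, c p.2)).
  have Ac x : A (c x) by exact: cA.
  move=> [x y] [z t] /= /(set_injX finj (Ac _) (Ac _) (Ac _) (Ac _))[].
  by move=> /cinj + /cinj; rewrite !in_setT => -> // ->.
move=> /pcard_leP/injfunPex[e eA einj].
have [d de] : exists d, forall x, A x -> d (e x) = x.
  have /choice[d de] y : exists x, (e @` A) y -> A x /\ e x = y.
    by have [[x Ax <-]|nAy] := pselect ((e @` A) y); [exists x|exists point].
  exists d => x Ax; have [|dA edE] := de (e x); first by exists x.
  by apply: einj edE; rewrite inE.
(* Outside [A], the set [D] lies in the image of [A] under [e], where [d] inverts [e]; hence all of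
   [D] injects into [A]. *)
pose D := A `|` e @` A.
have [x [[//|[y Ay <-] _]]|x y|c cA cinj] :=
    @square_absorbs_complement _ A f _ _ D d fA finj (Ai 0) (Ai 1) i01.
- by rewrite de.
- rewrite !inE => -[[//|[z Az <-]] _] [[//|[t At <-]] _].
  by rewrite !de// => ->.
pose h p := e (f (c p.1, c p.2)).
have hA p : (D `*` D) p -> (e @` A) (h p).
  by case=> Dp1 Dp2; exists (f (c p.1, c p.2)) => //; apply: fA; split; apply: cA.
have hinj p q : (D `*` D) p -> (D `*` D) q -> h p = h q -> p = q.
  move: p q => [x y] [z t] [/= Dx Dy] [/= Dz Dt] hxy.
  have Af a b : D a -> D b -> A (f (c a, c b)).
    by move=> Da Db; apply: fA; split; apply: cA.
  have {}hxy : f (c x, c y) = f (c z, c t).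
    by apply: einj hxy; rewrite inE; apply: Af.
  have [||||] := set_injX finj _ _ _ _ hxy; [exact: cA..|].
  by move=> /cinj + /cinj; rewrite !inE => -> // ->.
(* On [A * A] the values lie in [A], elsewhere in the image of [e], which is disjoint from [A]: the
   two branches cannot collide. *)
pose g p := if p \in A `*` A then f p else h p.
have gA : set_fun (D `*` D) D g.
  move=> p Dp; rewrite /g; case: ifPn; rewrite ?inE => Ap.
    by left; apply: fA.
  by right; apply: hA.
have ginj : set_inj (D `*` D) g.
  move=> p q; rewrite !inE /g => Dp Dq.
  have fh p' q' : (A `*` A) p' -> (D `*` D) q' -> f p' <> h q'.
    move=> Ap' /hA[x Ax exq] fhp; apply: (eA x Ax).
    by rewrite exq -fhp; apply: fA.
  case: ifPn; rewrite ?inE => Ap; case: ifPn; rewrite ?inE => Aq.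
  - by apply: finj; rewrite inE.
  - by move=> /fh[].
  - by move=> /esym/fh[].
  - exact: hinj.
have AD : A `<=` D by move=> x; left.
have De0 : D (e (i 0)) by right; exists (i 0).
(* By maximality the graph of [g] lies in [G], which would put [e (i 0)] into [A]. *)
exfalso; apply: (eA (i 0) (Ai 0)).
rewrite -[A]/(diag_dom G); exists (g (e (i 0), e (i 0))).
apply: (maxG (graph_on D g)) => //; last exact: square_graph_on.
rewrite GE => -[p x] [/= [Ap1 Ap2] ->]; split=> /=.
  by split; apply: AD.
by rewrite /g ifT// inE.
Qed.

Lemma infinite_seq (T : Type) :
  infinite_set [set: T] -> [set: seq T] #= [set: T].
Proof.
move=> Tinf; apply: Cantor_Bernstein; last first.
  by apply/injective_card_leP; exists (fun x => [:: x]) => x y [].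
have := Tinf => /infiniteP/injective_card_leP[i iinj].
have /card_eqPle[/injective_card_leP[f finj] _] := infinite_square Tinf.
(* The value [i 0] for the empty list is arbitrary and may also code a longer list; [code] separates
   lists of equal length, hence the length is recorded through [i]. *)
pose code s := foldr (fun x y => f (x, y)) (i 0) s.
have code_inj s t : size s = size t -> code s = code t -> s = t.
  elim: s t => [|x s IHs] [|y t]//= [/IHs{}IHs] /finj[-> /IHs ->//].
apply/injective_card_leP; exists (fun s => f (i (size s), code s)) => s t.
by move=> /finj[/iinj/code_inj] + /[dup].
Qed.

(** * Cardinal bounds for finitely supported functions *)

Section MalgCardinal.
Local Open Scope ring_scope.
Import GRing.Theory.

Lemma malg_card_le_fun (R : zmodType) (M : choiceType) :
  [set: {malg R[M]}] #<= [set: M -> R].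
Proof.
apply/injective_card_leP; exists (fun f x => f@_x) => f g fg.
by apply/malgP => x; apply: (congr1 (fun h => h x) fg).
Qed.

Lemma malg_card_ge_fun (R : zmodType) (M : choiceType) :
  finite_set [set: M] -> [set: M -> R] #<= [set: {malg R[M]}].
Proof.
move=> Mfin; apply/injective_card_leP.
exists (fun f => [malg x in fset_set [set: M] => f x]) => f g fg.
apply/funext => x; have /malgP/(_ x) := fg.
by rewrite !mcoeffE in_fset_set// in_setT.
Qed.

Lemma malg_card_le_seq (R : zmodType) (M : choiceType) :
  [set: {malg R[M]}] #<= [set: seq (R * M)].
Proof.
apply/injective_card_leP; exists (fun f => [seq (f@_x, x) | x <- msupp f]).
apply: (@can_inj _ _ _ (fun s => \sum_(p <- s) << p.1 *g p.2 >>)) => f.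
by rewrite big_map -monalgE.
Qed.

(* The coefficient of [r e + [x != e] x] at [e] is [r], and [x] is the only
   other element of its support, if there is one. *)
Lemma malg_card_ge_prod (R : nzRingType) (M : choiceType) (e : M) :
  [set: R * M] #<= [set: {malg R[M]}].
Proof.
apply/injective_card_leP.
exists (fun p => << p.1 *g e >> + << (p.2 != e)%:R *g p.2 >>).
move=> [r x] [s y] /malgP /= eqE.
have rs : r = s.
  by have := eqE e; rewrite !mcoeffD !mcoeffU eqxx; do 2![case: eqP => _ /=];
    rewrite ?mul0rn ?addr0.
have {eqE} eqE z : (x != e)%:R *+ (x == z) = (y != e)%:R *+ (y == z) :> R.
  by have := eqE z; rewrite !mcoeffD !mcoeffU rs => /addrI.
rewrite rs; congr (_, _); apply/eqP/negPn/negP => xy.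
(* If [x] and [y] differ, the coefficients at [y] and at [x] force [y = e] and [x = e], because [1]
   is not [0] in [R]. *)
have := eqE x; have := eqE y; rewrite !eqxx [y == x]eq_sym !(negPf xy) !mulr0n.
have [ye|_] := eqVneq y e; last by move=> /esym/eqP; rewrite oner_eq0.
have [xe|_] := eqVneq x e; first by rewrite xe ye eqxx in xy.
by move=> _ /eqP; rewrite oner_eq0.
Qed.
End MalgCardinal.

Theorem theorem1p2 (R : nzRingType) (M : monoidType) :
  (finite_set [set: M] -> [set: monoid_ring R M] #= [set: M -> R]) /\
  (infinite_set [set: M] -> [set: monoid_ring R M] #= [set: (R * M)%type]).
Proof.
split=> [Mfin|Minf]; apply: Cantor_Bernstein.
- exact: malg_card_le_fun.
- exact: malg_card_ge_fun.
- apply: card_le_trans (malg_card_le_seq R M) _.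
  suff /infinite_seq/card_eqPle[] : infinite_set [set: R * M] by [].
  apply: contra_not Minf; apply: card_le_finite.
  by apply/injective_card_leP; exists (pair 0%R) => x y [].
(* Any element of [M] could serve as base point; the identity is at hand. *)
- exact: malg_card_ge_prod (1%g : M).
Qed.
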